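(* Let $m,j\in\mathbb{N}$ with $m\geq 5$ and $1\leq j<\frac{m}{2}$. Then the generalized Petersen graph $G(m,j)$ admits a 3-balanced coloring if and only if $3\mid m$ and $3\nmid j$.
   Context: The generalized Petersen graph $G(m,j)$ has vertex set $\{v_i,u_i : i\in\mathbb{Z}_m\}$ and edges $v_iv_{i+1}$, $v_iu_i$, and $u_iu_{i+j}$ for $i\in\mathbb{Z}_m$. A coloring $\ell:V\to\mathbb{Z}_3$ of the vertices of a graph is 3-balanced if every vertex has, in its open neighborhood, the same number of vertices of each of the three colors. *)

(* Defs.v *)
From mathcomp Require Import all_boot all_order all_algebra.
Set Implicit Arguments.
Unset Strict Implicit.
Unset Printing Implicit Defensive.
Import GRing.Theory.
Local Open Scope ring_scope.

(* [inl i] is v_i and [inr i] is u_i.  Since 'Z_m is the integers mod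
   [max m 2], this is only meaningful for [1 < m]. *)
Definition gp_vertex (m : nat) : finType := ('Z_m + 'Z_m)%type.

(* One orientation of each edge family. *)
Definition gp_arc (m j : nat) : rel (gp_vertex m) := fun x y =>
  match x, y with
  | inl i, inl k => k == i + 1
  | inl i, inr k => k == i
  | inr i, inr k => k == i + j%:R
  | inr _, inl _ => false
  end.

Definition gp_adj (m j : nat) : rel (gp_vertex m) :=
  fun x y => gp_arc j x y || gp_arc j y x.

Definition open_nbhd (T : finType) (e : rel T) (x : T) : {set T} :=
  [set y | e x y].

Definition balanced3 (T : finType) (e : rel T) (l : T -> 'Z_3) : Prop :=
  forall (x : T) (c d : 'Z_3),
    #|[set y in open_nbhd e x | l y == c]| =
    #|[set y in open_nbhd e x | l y == d]|.

Lemma gp_adj_sym (m j : nat) : symmetric (@gp_adj m j).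
Proof. by move=> x y; rewrite /gp_adj orbC. Qed.

Lemma gp_adj_irr (m j : nat) (hm : (1 < m)%N) (hj : (0 < j < m)%N) :
  irreflexive (@gp_adj m j).
Proof.
case/andP: hj => j0 jm.
move=> [i|i]; rewrite /gp_adj orbb /= -{1}[i]addr0 (inj_eq (addrI i)).
  by rewrite eq_sym oner_eq0.
apply/negbTE; rewrite eq_sym -(inj_eq val_inj) /= val_Zp_nat // modn_small //.
by rewrite -lt0n.
Qed.

(* Main.v *)
(* In a balanced coloring every vertex has exactly one neighbor of color 0, so
   [x_i = 3 [l v_i = 0] - 1] and [y_i = 3 [l u_i = 0] - 1] satisfy
   [x_(i+1) + x_(i-1) + y_i = 0] and [y_(i+j) + y_(i-j) + x_i = 0].  For an
   m-th root of unity z, the Fourier coefficient [X = \sum_i x_i z^i] therefore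
   satisfies [X = (z + z^-1) (z^j + z^-j) X].  Let n be the largest power of 3
   dividing m.  If the arithmetic condition fails, then either 3 divides j or
   n = 1, and in both cases [(z + z^-1) (z^j + z^-j) != 1] whenever z^n = 1, so
   these coefficients vanish.  Summing them over all such z yields [m = 3 n B],
   where B is the number of v_i of color 0 with n | i, contradicting the choice
   of n.  Conversely, [v_i, u_i |-> i mod 3] is balanced. *)
Require Import Defs.
From mathcomp Require Import all_boot all_order all_algebra all_field.
From mathcomp Require Import ring zify.
Set Implicit Arguments.
Unset Strict Implicit.
Unset Printing Implicit Defensive.
Import GRing.Theory Num.Theory.

Local Open Scope ring_scope.

(** * Geometric sums and Fourier shifts modulo [m] *)

Lemma sum_unity_root (F : fieldType) (n : nat) (z : F) :
  z ^+ n = 1 -> \sum_(i < n) z ^+ i = if z == 1 then n%:R else 0.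
Proof.
move=> zn; case: eqP => [-> | /eqP z1].
  by under eq_bigr => i _ do rewrite expr1n; rewrite sumr_const card_ord.
by apply: (mulfI (x := z - 1)); rewrite ?subr_eq0 // -subrX1 zn subrr mulr0.
Qed.

Section ZpExponents.
Variables (m : nat) (hm : (1 < m)%N).

(** Exponents in ['Z_m] are read as representatives below [m]; [z ^+ m = 1] absorbs the reduction
    modulo [m]. *)
Lemma expr_ZpD (R : pzSemiRingType) (z : R) (i k : 'Z_m) :
  z ^+ m = 1 -> z ^+ (i + k)%R = z ^+ i * z ^+ k.
Proof.
case: m hm i k => [|[|n]] // _ i k zm.
by rewrite -exprD /= expr_mod.
Qed.

Lemma expr_Zp_nat (R : pzSemiRingType) (z : R) (k : nat) :
  z ^+ m = 1 -> z ^+ (k%:R : 'Z_m) = z ^+ k.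
Proof. by move=> zm; rewrite val_Zp_nat // expr_mod. Qed.

(** Reindexing by a translation; this turns recurrences on ['Z_m] into linear equations between
    Fourier coefficients. *)
Lemma sum_shift_Zp (F : fieldType) (z : F) (f : 'Z_m -> F) (s : nat) :
  z ^+ m = 1 ->
  \sum_i f (i - s%:R) * z ^+ i = z ^+ s * \sum_i f i * z ^+ i.
Proof.
move=> zm; rewrite (reindex_inj (addIr (s%:R))) mulr_sumr.
apply: eq_bigr => i _; rewrite addrK expr_ZpD // expr_Zp_nat //; ring.
Qed.

Lemma sum_shift_Zp_opp (F : fieldType) (z : F) (f : 'Z_m -> F) (s : nat) :
  z ^+ m = 1 ->
  \sum_i f (i + s%:R) * z ^+ i = z ^- s * \sum_i f i * z ^+ i.
Proof.
move=> zm.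
have z0 : z ^+ s != 0.
  rewrite expf_neq0 //; apply/eqP => z0; move: zm.
  by rewrite z0 expr0n -[m]prednK ?(ltnW hm) //= => /esym/eqP; rewrite oner_eq0.
apply: (mulfI z0); rewrite mulVKf //.
rewrite -(sum_shift_Zp (fun i => f (i + s%:R))) //; apply: eq_bigr => i _.
by rewrite subrK.
Qed.

End ZpExponents.

(** * The cosine product at roots of unity of 3-power order *)

(* If 9 divides the order [3 * q] of [z], the Galois automorphism
   [z |-> z ^+ q.+1] multiplies [z] by a primitive cube root of unity but fixes
   [z ^+ j], as [3 %| j]. *)
Lemma cos_prod_neq1 (j e : nat) (z : algC) :
  (3 %| j)%N -> z ^+ (3 ^ e) = 1 -> (z + z^-1) * (z ^+ j + z ^- j) != 1.
Proof.
move=> j3 ze; apply/eqP => E.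
have [n prn] := prim_order_exists (expn_gt0 3 e) ze.
case/(dvdn_pfactor _ _ (isT : prime 3)) => k _ nk; subst n.
have zn := prim_expr_order prn.
have z0 : z != 0 by rewrite (prim_root_eq0 prn) -lt0n expn_gt0.
case: k prn zn => [|[|k]] prn zn.
- move: E; rewrite -[z]expr1 zn expr1n invr1.
  rewrite (_ : _ * _ = 4%:R :> algC); last by ring.
  by move/eqP; rewrite (eqr_nat _ 4 1).
(* Order 3: here [z + z^-1] is -1 and [z ^+ j] is 1, so the product is -2. *)
- move/dvdnP: j3 E => [t ->]; rewrite mulnC exprM zn expr1n invr1 => E.
  have z1 : z - 1 != 0.
    by rewrite subr_eq0 -[z]expr1 -(prim_order_dvd prn).
  have z2 : z ^+ 2 + z + 1 = 0.
    apply: (mulfI z1); rewrite mulr0; have := zn; rewrite expn1 => z3.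
    have -> : (z - 1) * (z ^+ 2 + z + 1) = z ^+ 3 - 1 by ring.
    by rewrite z3 subrr.
  have : 3 * z = 0.
    have -> : 3 * z = 2 * (z ^+ 2 + z + 1) - (z * ((z + z^-1) * (1 + 1)) - z).
      by field.
    by rewrite E z2; ring.
  by move/eqP; rewrite mulf_eq0 pnatr_eq0 (negPf z0).
(* The order is [3 * q] with 3 dividing [q], so [q.+1] is coprime to it and [z ^+ q] is a primitive
   cube root of unity. *)
set q := (3 ^ k.+1)%N in prn zn *.
have nq : (3 ^ k.+2 = 3 * q)%N by rewrite expnS.
have cop : coprime q.+1 (3 ^ k.+2).
  rewrite coprime_pexpr // coprime_sym prime_coprime // -[q.+1]addn1 /q.
  by rewrite expnS dvdn_addr // dvdn_mulr.
have [u uE] := Qn_aut_exists cop.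
set v := z ^+ q; set C := z ^+ j + z ^- j in E.
have v3 : v ^+ 3 = 1 by rewrite -exprM mulnC -nq zn.
have v1 : v - 1 != 0.
  rewrite subr_eq0 -(prim_order_dvd prn) nq gtnNdvd ?expn_gt0 //.
  by rewrite -[ltnLHS]mul1n ltn_pmul2r // expn_gt0.
have v2 : v ^+ 2 + v + 1 = 0.
  apply: (mulfI v1); rewrite mulr0.
  have -> : (v - 1) * (v ^+ 2 + v + 1) = v ^+ 3 - 1 by ring.
  by rewrite v3 subrr.
have v0 : v != 0 by rewrite expf_neq0.
have uz : u z = z * v by rewrite uE // exprS.
have vj : v ^+ j = 1 by case/dvdnP: j3 => t ->; rewrite mulnC exprM v3 expr1n.
have C0 : C != 0.
  by apply/eqP => C0; move/eqP: E; rewrite C0 mulr0 eq_sym oner_eq0.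
have uC : u C = C by rewrite rmorphD fmorphV rmorphXn /= uz exprMn vj mulr1.
(* Apply [u] to [E] and cancel the fixed factor [C]: [u] fixes [z + z^-1]. Hence
   [z ^+ 2 = v^-1 = v ^+ 2] and [z ^+ 6 = 1], although 9 divides the order of [z]. *)
have E2 : (z + z^-1) - (z * v + (z * v)^-1) = 0.
  apply: (mulIf C0); rewrite mul0r mulrBl E; apply/eqP; rewrite subr_eq0 eq_sym.
  by rewrite -(rmorph1 u) -E rmorphM uC rmorphD fmorphV /= uz.
have E3 : z ^+ 2 + 1 + v = 0.
  apply: (mulfI v1); rewrite mulr0.
  have -> : (v - 1) * (z ^+ 2 + 1 + v)
     = - (z * ((z + z^-1) - (z * v + (z * v)^-1))) + (v ^+ 3 - 1) / v.
    by field; rewrite z0 v0.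
  by rewrite E2 v3 subrr; ring.
have : z ^+ 6 = 1.
  have z2 : z ^+ 2 = v ^+ 2.
    apply/eqP; rewrite -subr_eq0; apply/eqP.
    have -> : z ^+ 2 - v ^+ 2 = (z ^+ 2 + 1 + v) - (v ^+ 2 + v + 1) by ring.
    by rewrite E3 v2 subr0.
  by rewrite (exprM z 2 3) z2 -exprM (exprM v 3 2) v3 expr1n.
move/eqP; rewrite -(prim_order_dvd prn) => /(dvdn_trans _) H.
by have := H 9 (dvdn_exp2l 3 (isT : (2 <= k.+2)%N)).
Qed.

(** * Color counts in neighborhoods of three vertices *)

Lemma card_nbhd_color (T : finType) (e : rel T) (C : eqType) (l : T -> C)
    (x a b c : T) (d : C) :
  uniq [:: a; b; c] -> open_nbhd e x =i [:: a; b; c] ->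
  #|[set y in open_nbhd e x | l y == d]| =
  ((l a == d) + (l b == d) + (l c == d))%N.
Proof.
move=> U N; rewrite -addnA -[RHS]addn0 -!addnA -/(count (fun y => l y == d) [:: a; b; c]).
rewrite -size_filter -(card_uniqP (filter_uniq _ U)).
by apply: eq_card => y; rewrite mem_filter -N !inE andbC.
Qed.

(** The counts of the three colors add up to 3, so equal counts are all 1. *)
Lemma Z3_equicolored (a b c : 'Z_3) :
  (forall d d', ((a == d) + (b == d) + (c == d))%N =
                ((a == d') + (b == d') + (c == d'))%N) ->
  forall d, ((a == d) + (b == d) + (c == d))%N = 1%N.
Proof.
move=> H d.
have : forall y : 'Z_3, ((y == 0%R) + (y == 1%R) + (y == 2%:R) = 1)%N.
  by case=> [[|[|[|]]] ?].
move=> S; move: (S a) (S b) (S c) (H 0 d) (H 1 d) (H 2%:R d).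
do 12! move: (nat_of_bool _) => ?.
lia.
Qed.

Lemma Z3_equispaced (a s d : 'Z_3) :
  s != 0 -> (((a + s)%R == d) + ((a - s)%R == d) + (a == d))%N = 1%N.
Proof.
by case: a => [[|[|[|]]] ?]; case: s => [[|[|[|]]] ?];
  case: d => [[|[|[|]]] ?].
Qed.

Section Petersen.
Variables (m j : nat) (hm : (2 < m)%N) (hj1 : (0 < j)%N) (hj2 : (2 * j < m)%N).

Let m1 : (1 < m)%N := ltnW hm.

(** As [0 < 2 * s < m], the difference [2 * s] is nonzero modulo [m]. This keeps the neighbors at
    offsets [s] and [-s] distinct. *)
Lemma Zp_opp_neq (i : 'Z_m) (s : nat) :
  (0 < s)%N -> (2 * s < m)%N -> i + s%:R != i - s%:R.
Proof.
move=> s0 s2; rewrite (inj_eq (addrI i)) -subr_eq0 opprK -natrD addnn -mul2n.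
by rewrite -(inj_eq val_inj) /= val_Zp_nat // modn_small // muln_eq0 -lt0n s0.
Qed.

Lemma nbhd_outer (C : eqType) (l : gp_vertex m -> C) (i : 'Z_m) (d : C) :
  #|[set y in open_nbhd (@gp_adj m j) (inl i) | l y == d]| =
  ((l (inl (i + 1%:R)%R) == d) + (l (inl (i - 1%:R)%R) == d) + (l (inr i) == d))%N.
Proof.
apply: card_nbhd_color => [|[k|k]].
- rewrite /= !inE /= orbF andbT; apply: contraNN (Zp_opp_neq i (isT : (0 < 1)%N) hm).
  by move=> /eqP E; apply/eqP/(@inl_inj 'Z_m 'Z_m).
- rewrite !inE /gp_adj /= orbF.
  by rewrite -[i == k + _]subr_eq [i - _ == k]eq_sym.
- by rewrite !inE /gp_adj /= orbF.
Qed.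

Lemma nbhd_inner (C : eqType) (l : gp_vertex m -> C) (i : 'Z_m) (d : C) :
  #|[set y in open_nbhd (@gp_adj m j) (inr i) | l y == d]| =
  ((l (inr (i + j%:R)%R) == d) + (l (inr (i - j%:R)%R) == d) + (l (inl i) == d))%N.
Proof.
apply: card_nbhd_color => [|[k|k]].
- rewrite /= !inE /= orbF andbT; apply: contraNN (Zp_opp_neq i hj1 hj2).
  by move=> /eqP E; apply/eqP/(@inr_inj 'Z_m 'Z_m).
- by rewrite !inE /gp_adj /= eq_sym.
- rewrite !inE /gp_adj /= orbF.
  by rewrite -[i == k + _]subr_eq [i - _ == k]eq_sym.
Qed.

Lemma balanced3_gpP (l : gp_vertex m -> 'Z_3) :
  balanced3 (@gp_adj m j) l <->
  forall (i : 'Z_m) (d : 'Z_3),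
    ((l (inl (i + 1%:R)%R) == d) + (l (inl (i - 1%:R)%R) == d) + (l (inr i) == d)
       = 1)%N /\
    ((l (inr (i + j%:R)%R) == d) + (l (inr (i - j%:R)%R) == d) + (l (inl i) == d)
       = 1)%N.
Proof.
split=> [B i d | H [i|i] d d'].
- split; apply: Z3_equicolored => e e'.
    by rewrite -!nbhd_outer; apply: B.
  by rewrite -!nbhd_inner; apply: B.
- by rewrite !nbhd_outer !(H i _).1.
- by rewrite !nbhd_inner !(H i _).2.
Qed.

(** * Necessity, by Fourier coefficients *)

Lemma balanced3_fourier (x y : 'Z_m -> algC) (z : algC) :
  z ^+ m = 1 ->
  (forall i, x (i + 1%:R) + x (i - 1%:R) + y i = 0) ->
  (forall i, y (i + j%:R) + y (i - j%:R) + x i = 0) ->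
  (z + z^-1) * (z ^+ j + z ^- j) != 1 ->
  \sum_i x i * z ^+ i = 0.
Proof.
move=> zm Hx Hy H.
set X := \sum_i _; set Y := \sum_i y i * z ^+ i.
have E1 : z ^- 1 * X + z ^+ 1 * X + Y = 0.
  rewrite -sum_shift_Zp_opp // -sum_shift_Zp // -!big_split big1 // => i _ /=.
  by rewrite -!mulrDl Hx mul0r.
have E2 : z ^- j * Y + z ^+ j * Y + X = 0.
  rewrite -sum_shift_Zp_opp // -sum_shift_Zp // -!big_split big1 // => i _ /=.
  by rewrite -!mulrDl Hy mul0r.
rewrite expr1 in E1.
apply/eqP; rewrite -[_ == 0]/(X == 0).
have : ((z + z^-1) * (z ^+ j + z ^- j) - 1) * X = 0.
  (* This combination of [E1] and [E2] eliminates [Y]. *)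
  have -> : ((z + z^-1) * (z ^+ j + z ^- j) - 1) * X =
    (z ^+ j + z ^- j) * (z^-1 * X + z * X + Y) - (z ^- j * Y + z ^+ j * Y + X).
    by ring.
  by rewrite E1 E2; ring.
by move/eqP; rewrite mulf_eq0 subr_eq0 (negPf H).
Qed.

Lemma balanced3_dvd (l : gp_vertex m -> 'Z_3) :
  balanced3 (@gp_adj m j) l -> (3 %| m)%N /\ ~~ (3 %| j)%N.
Proof.
move/balanced3_gpP => H.
set e := logn 3 m; set n := (3 ^ e)%N.
have nm : (n %| m)%N by exact: pfactor_dvdnn.
have n0 : (0 < n)%N by rewrite expn_gt0.
apply/andP; apply: contraT => Hn.
have neq (z : algC) : z ^+ n = 1 -> (z + z^-1) * (z ^+ j + z ^- j) != 1.
  move=> zn; have [j3 | j3] := boolP (3 %| j)%N; first exact: cos_prod_neq1 zn.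
  have m3 : ~~ (3 %| m)%N by rewrite j3 andbT in Hn.
  have e0 : e = 0%N by rewrite /e lognE (negPf m3) andbF.
  have z1 : z = 1 by rewrite -[z]expr1 -zn /n e0.
  (* At [z = 1] the product does not depend on [j], so exponent 0, a multiple of 3, serves
     instead. *)
  have := @cos_prod_neq1 0 0 z (dvdn0 3).
  by rewrite z1 !expr1n; apply.
pose b (v : gp_vertex m) : algC := (l v == 0)%:R.
have X0 (z : algC) : z ^+ n = 1 ->
  \sum_(i : 'Z_m) (3 * b (inl i) - 1) * z ^+ i = 0.
  move=> zn.
  apply: (balanced3_fourier (y := fun i => 3 * b (inr i) - 1)); last exact: neq.
  - by case/dvdnP: nm => t ->; rewrite mulnC exprM zn expr1n.
  - move=> i; have [/(congr1 (GRing.natmul (1 : algC))) + _] := H i 0.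
    rewrite !natrD -/(b _) -/(b _) -/(b (inr _)) => E.
    rewrite [LHS](_ : _ = 3 * (b (inl (i + 1%:R)) + b (inl (i - 1%:R)) + b (inr i)) - 3).
      by rewrite E; ring.
    by ring.
  - move=> i; have [_ /(congr1 (GRing.natmul (1 : algC)))] := H i 0.
    rewrite !natrD -/(b _) -/(b _) -/(b (inl _)) => E.
    rewrite [LHS](_ : _ = 3 * (b (inr (i + j%:R)) + b (inr (i - j%:R)) + b (inl i)) - 3).
      by rewrite E; ring.
    by ring.
have [w prw] := C_prim_root_exists n0.
have wn := prim_expr_order prw.
pose B := (\sum_(i : 'Z_m) (n %| i) * (l (inl i) == 0%R))%N.
(* Orthogonality: summing over [t] gives [n] when [n] divides [i], and 0 otherwise. *)
have S1 : \sum_(t < n) \sum_(i : 'Z_m) (3 * b (inl i)) * (w ^+ t) ^+ i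
          = (3 * n * B)%:R.
  rewrite exchange_big natrM natr_sum mulr_sumr; apply: eq_bigr => i _ /=.
  rewrite -mulr_sumr; under eq_bigr => t _ do rewrite -exprM mulnC exprM.
  rewrite sum_unity_root; last by rewrite -exprM mulnC exprM wn expr1n.
  rewrite -(prim_order_dvd prw) /b !natrM.
  by case: (n %| i)%N; rewrite /=; ring.
(* Only [t = 0] contributes: otherwise [w ^+ t] is an [m]-th root of unity other than 1. *)
have S2 : \sum_(t < n) \sum_(i : 'Z_m) (w ^+ t) ^+ i = m%:R.
  rewrite (bigD1 (Ordinal n0)) //= [X in _ + X]big1 => [|t t0].
    rewrite sum_unity_root ?expr0 ?expr1n // eqxx addr0.
    by rewrite Zp_cast.
  rewrite sum_unity_root.
    rewrite -(prim_order_dvd prw) gtnNdvd // lt0n.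
    by apply: contraNN t0 => /eqP t0; apply/eqP/val_inj.
  by rewrite Zp_cast //; case/dvdnP: nm => r ->;
    rewrite -exprM mulnA mulnC exprM wn expr1n.
have : (m %:R : algC) = (3 * n * B)%:R.
  rewrite -S1 -S2; apply/eqP; rewrite eq_sym -subr_eq0 -sumrB big1 // => t _.
  rewrite -sumrB -[RHS](X0 (w ^+ t)); last by rewrite -exprM mulnC exprM wn expr1n.
  by apply: eq_bigr => i _; rewrite mulrBl mul1r.
move/eqP; rewrite eqr_nat => /eqP mE.
have : (3 ^ e.+1 %| m)%N by rewrite expnS mE dvdn_mulr.
by rewrite pfactor_dvdn ?ltnn // (ltn_trans _ hm).
Qed.

(** * Sufficiency, by coloring modulo 3 *)

Lemma dvd_balanced3 :
  (3 %| m)%N -> ~~ (3 %| j)%N ->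
  exists l : gp_vertex m -> 'Z_3, balanced3 (@gp_adj m j) l.
Proof.
(* As 3 divides [m], [h] is additive; each neighborhood then has colors [a + s], [a - s], [a] with
   [s] equal to 1 or [j], nonzero modulo 3. *)
move=> m3 j3; pose h (i : 'Z_m) : 'Z_3 := (i : nat)%:R.
have h_nat k : h (k%:R) = k%:R.
  by rewrite /h val_Zp_nat //; apply: ord_inj; rewrite !val_Zp_nat // modn_dvdm.
have hD i k : h (i + k) = h i + h k.
  rewrite /h -natrD; apply: ord_inj; rewrite !val_Zp_nat //.
  by case: m m3 m1 i k => [|[|r]] // r3 _ i k; rewrite /= modn_dvdm.
have hB i k : h (i - k) = h i - h k.
  by apply: (addIr (h k)); rewrite -hD !subrK.
exists (fun v => match v with inl i => h i | inr i => h i end).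
apply/balanced3_gpP => i d; rewrite !hB !hD !h_nat; split; apply: Z3_equispaced.
  by [].
by rewrite -(inj_eq val_inj) /= val_Zp_nat.
Qed.

End Petersen.

Local Close Scope ring_scope.

Theorem theorem4p2 (m j : nat) (hm : 5 <= m) (hj1 : 1 <= j) (hj2 : 2 * j < m) :
  (exists l : gp_vertex m -> 'Z_3, balanced3 (@gp_adj m j) l) <->
  (3 %| m) /\ ~~ (3 %| j).
Proof.
have m2 : 2 < m by exact: leq_trans hm.
split=> [[l] | [m3 j3]]; first exact: balanced3_dvd m2 hj1 hj2 l.
exact: dvd_balanced3.
Qed.
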